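(* Let $n\geq 3$ be an integer. There exists a positive formula $\psi_n(a,b)$ of the first-order language $\mathcal{L}$ with the two free variables $a,b$ such that for every $n$-dimensional affine space $\mathbf{A}$ (including those in which every line is incident with exactly two points) and all lines $a,b$ of $\mathbf{A}$: $\psi_n(a,b)$ holds in the $\mathcal{L}$-structure of lines of $\mathbf{A}$ if and only if $a\sim b$ does not hold. In other words, in affine geometry of dimension $n\geq 3$, non-intersection of two lines is positively definable in terms of line-intersection.
   Context: $\mathcal{L}$ is the one-sorted first-order language with equality whose only non-logical symbol is a binary relation symbol $\sim$. For an affine space $\mathbf{A}$, the $\mathcal{L}$-structure of lines of $\mathbf{A}$ has as universe the set of all lines of $\mathbf{A}$, and $a\sim b$ is interpreted as ''$a$ and $b$ are different lines which have a point in common''. Thus $a\sim b$ fails exactly when $a=b$ or $a$ and $b$ have no common point (i.e. are parallel or skew). A formula of $\mathcal{L}$ is positive if it is built from atomic formulas ($x\sim y$ and $x=y$, with $x,y$ variables) using only $\wedge$, $\vee$, $\forall$, $\exists$ (no negation, no implication); the formula $a\sim a$ serves as an identically false formula. The formula depends only on $n$, not on the space. Affine spaces in which every line has exactly two points are those coordinatized by $\mathrm{GF}(2)$. *)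

(* Defs.v *)
From HB Require Import structures.
From mathcomp Require Import all_boot all_order all_algebra.
From mathcomp Require Import boolp classical_sets.

Set Implicit Arguments.
Unset Strict Implicit.
Unset Printing Implicit Defensive.

Import GRing.Theory.

(* First-order formulas over one binary relation symbol ~ and equality.
   Variables are natural numbers. *)
Inductive formula : Type :=
  | FAdj (i j : nat)
  | FEq (i j : nat)
  | FNot (f : formula)
  | FAnd (f g : formula)
  | FOr (f g : formula)
  | FImp (f g : formula)
  | FForall (i : nat) (f : formula)
  | FExists (i : nat) (f : formula).

Fixpoint positive (f : formula) : bool :=
  match f with
  | FAdj _ _ | FEq _ _ => true
  | FNot _ | FImp _ _ => false
  | FAnd g h | FOr g h => positive g && positive h
  | FForall _ g | FExists _ g => positive g
  end.

Fixpoint free_vars (f : formula) : seq nat :=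
  match f with
  | FAdj i j | FEq i j => [:: i; j]
  | FNot g => free_vars g
  | FAnd g h | FOr g h | FImp g h => free_vars g ++ free_vars h
  | FForall i g | FExists i g => [seq j <- free_vars g | j != i]
  end.

Definition update (M : Type) (e : nat -> M) (i : nat) (x : M) : nat -> M :=
  fun j => if j == i then x else e j.

Fixpoint sat (M : Type) (adj : M -> M -> Prop) (e : nat -> M) (f : formula)
    : Prop :=
  match f with
  | FAdj i j => adj (e i) (e j)
  | FEq i j => e i = e j
  | FNot g => ~ sat adj e g
  | FAnd g h => sat adj e g /\ sat adj e h
  | FOr g h => sat adj e g \/ sat adj e h
  | FImp g h => sat adj e g -> sat adj e h
  | FForall i g => forall x : M, sat adj (update e i x) g
  | FExists i g => exists x : M, sat adj (update e i x) g
  end.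

Local Open Scope ring_scope.

(* A nonempty set of points on which the additive group of an n-dimensional
   left vector space over a division ring acts simply transitively. The
   scalars need not commute: unitRingType together with GRing.field_axiom is
   exactly a division ring. *)
Record affineSpace (n : nat) : Type := AffineSpace {
  scalars : unitRingType;
  scalars_div : GRing.field_axiom scalars;
  directions : vectType scalars;
  dim_directions : dim directions = n;
  points : Type;
  points_inhabited : inhabited points;
  translate : points -> directions -> points;
  translate0 : forall p, translate p 0 = p;
  translateD : forall p u v, translate p (u + v) = translate (translate p u) v;
  translate_simply_transitive : forall p q, exists! v, translate p v = q
}.

Local Open Scope classical_set_scope.

Definition is_line (n : nat) (A : affineSpace n) (l : set (points A)) : Prop :=
  exists (p : points A) (v : directions A),
    v != 0 /\ l = range (fun k : scalars A => translate p (k *: v)).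

(* Equality of elements of this type is equality of the underlying point sets,
   by proof irrelevance. *)
Definition line (n : nat) (A : affineSpace n) : Type :=
  {l : set (points A) | is_line l}.

Definition lines_meet (n : nat) (A : affineSpace n) (a b : line A) : Prop :=
  a <> b /\ exists p : points A, sval a p /\ sval b p.

(* Main.v *)
Require Import Defs.
From mathcomp Require Import all_boot all_order all_algebra zify.
From mathcomp Require Import boolp classical_sets.

Set Implicit Arguments.
Unset Strict Implicit.
Unset Printing Implicit Defensive.

Import GRing.Theory.
Local Open Scope ring_scope.

(** Non-intersection is definable because homomorphisms of line structures are
rigid. A map of lines that preserves intersection and is onto must preserve
non-intersection, and every step of the argument for this can be turned into a
positive formula, where the universal quantifiers over lines play the part of
surjectivity.

Points are pairs of intersecting lines. That a third line passes through their
common point is a positive condition (concurrentP): through a point one can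
join to every line, whereas the lines that meet all three sides of a triangle
lie in its plane and cannot reach a line disjoint from that plane. That two
points are distinct is also positive (neq_pointsP). So one may use formulas on
points and lines with incidence, equality and distinctness of points, where
points are quantified existentially only.

Suppose that lines have at least three points. Then joining distinct points,
finitely often, generates the whole affine hull of a set of points. Hence a and
b are not coplanar if and only if some n - 3 points together with a and b
generate a point on every line (spread_complete, spread_not_coplanar): if a and
b are coplanar, everything generated stays in a hyperplane, and some line is
parallel to that hyperplane and misses it. Distinct parallel lines a and b are
recognized with a line c that is skew to both: each line y that is not parallel
to a is skew to a or to b or meets both in distinct points, and each line y
parallel to a is skew to c or meets c. If a and b met, the parallel to c through
their common point would have none of these properties
(par_witness_not_meet).

If lines have two points, joins generate nothing new, but a and b are disjoint
as soon as they carry four distinct points. This is only correct if lines have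
two points, which is ensured by asking for 2 ^ n points that block all lines:
they exist over GF(2), where they are all the points, while over other division
rings there are at least 3 ^ (n - 1) > 2 ^ n parallel lines to be blocked
(binary_blocked, ternary_not_blocked). *)

(** * Linear algebra over a division ring *)

Section LinearAlgebra.
Variables (R : unitRingType) (Rdiv : GRing.field_axiom R).

Section Span.
Variable V : lmodType R.
Implicit Types (s t : seq V) (v w x y : V) (k : R).

Fixpoint lin_span s v : Prop :=
  if s is e :: s' then exists k w, lin_span s' w /\ v = k *: e + w else v = 0.

(** Linear independence in the triangular form on which exchange arguments run. *)
Fixpoint lin_free s : Prop :=
  if s is e :: s' then ~ lin_span s' e /\ lin_free s' else True.

Lemma lin_spanD s v w : lin_span s v -> lin_span s w -> lin_span s (v + w).
Proof.
elim: s v w => [|e s IH] v w /=; first by move=> -> ->; rewrite addr0.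
move=> [k [v' [sv ->]]] [l [w' [sw ->]]].
by exists (k + l), (v' + w'); split; [exact: IH|rewrite scalerDl addrACA].
Qed.

Lemma lin_spanZ s k v : lin_span s v -> lin_span s (k *: v).
Proof.
elim: s v => [|e s IH] v /=; first by move=> ->; rewrite scaler0.
move=> [l [w [sw ->]]]; exists (k * l), (k *: w).
by split; [exact: IH|rewrite scalerDr scalerA].
Qed.

Lemma lin_spanN s v : lin_span s v -> lin_span s (- v).
Proof. by move=> /(lin_spanZ (-1)); rewrite scaleN1r. Qed.

Lemma lin_spanB s v w : lin_span s v -> lin_span s w -> lin_span s (v - w).
Proof. by move=> sv sw; apply: lin_spanD sv (lin_spanN sw). Qed.

Lemma lin_span0 s : lin_span s 0.
Proof.
by elim: s => //= e s IH; exists 0, 0; split=> //; rewrite scale0r addr0.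
Qed.

Lemma lin_span_consr e s v : lin_span s v -> lin_span (e :: s) v.
Proof. by move=> sv; exists 0, v; rewrite scale0r add0r. Qed.

Lemma lin_span_mem s v : v \in s -> lin_span s v.
Proof.
elim: s => //= e s IH; rewrite inE => /orP[/eqP->|vs].
  by exists 1, 0; split; [exact: lin_span0|rewrite scale1r addr0].
by apply: lin_span_consr; apply: IH.
Qed.

Lemma lin_span_sub s t v :
  (forall e, e \in s -> lin_span t e) -> lin_span s v -> lin_span t v.
Proof.
elim: s v => [|e s IH] v st /=; first by move=> ->; apply: lin_span0.
move=> [k [w [sw ->]]]; apply: lin_spanD.
  by apply/lin_spanZ/st; rewrite inE eqxx.
by apply: IH sw => e' e's; apply: st; rewrite inE e's orbT.
Qed.

Lemma lin_span_subseq s t v : {subset s <= t} -> lin_span s v -> lin_span t v.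
Proof. by move=> st; apply: lin_span_sub => e /st; apply: lin_span_mem. Qed.

Lemma lin_span1 e v : lin_span [:: e] v <-> exists k, v = k *: e.
Proof.
split=> [[k [_ [-> ->]]]|[k ->]]; first by exists k; rewrite addr0.
by exists k, 0; rewrite addr0.
Qed.

Lemma lin_span_divl s k v : k != 0 -> lin_span s (k *: v) -> lin_span s v.
Proof.
move=> k0 /(lin_spanZ k^-1); rewrite scalerA mulVr ?scale1r //.
exact: Rdiv.
Qed.

(** If x depends on s ++ t but not on s, then it involves some member of t,
    which conversely depends on x and the remaining vectors. *)
Lemma lin_span_exchange s t x :
  lin_span (s ++ t) x -> ~ lin_span s x ->
  exists t1 y t2, t = t1 ++ y :: t2 /\ lin_span (x :: s ++ t1 ++ t2) y.
Proof.
elim: t => [|y t IH]; first by rewrite cats0.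
move=> sx nsx; have [stx|nstx] := EM (lin_span (s ++ t) x).
  have [t1 [z [t2 [-> zspan]]]] := IH stx nsx.
  exists (y :: t1), z, t2; split=> //.
  apply: lin_span_subseq zspan => e; rewrite !(inE, mem_cat).
  by case/or4P=> ->; rewrite ?orbT.
have /= [k [w [stw xE]]] : lin_span (y :: s ++ t) x.
  apply: lin_span_subseq sx => e; rewrite !(inE, mem_cat).
  by case/or3P=> ->; rewrite ?orbT.
exists [::], y, t; split=> //=.
have k0 : k != 0.
  by apply/eqP => k0; apply: nstx; rewrite xE k0 scale0r add0r.
suff [l [u [su ->]]] : lin_span (x :: s ++ t) y by exists l, u.
apply: (lin_span_divl k0).
have -> : k *: y = x - w by rewrite xE addrK.
apply: lin_spanB; last exact: lin_span_consr.
by apply: lin_span_mem; rewrite inE eqxx.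
Qed.

(** Steinitz: a spanning family stays spanning when some of its members are
    traded for the members of a free family. *)
Lemma steinitz s t :
  lin_free s -> (forall v, lin_span t v) ->
  exists t', size s + size t' = size t /\ (forall v, lin_span (s ++ t') v).
Proof.
elim: s => [|x s IH]; first by move=> _ spant; exists t.
move=> [nsx frees] spant; have [t' [szt' spant']] := IH frees spant.
have [t1 [y [t2 [t'E yspan]]]] := lin_span_exchange (spant' x) nsx.
exists (t1 ++ t2); split=> [|v].
  by move: szt'; rewrite t'E !size_cat /=; lia.
apply: (lin_span_sub _ (spant' v)) => e; rewrite t'E !(mem_cat, inE).
case: (e =P y) => [-> _|_ H]; first exact: yspan.
apply: lin_span_mem.
by rewrite !(inE, mem_cat); move: H; rewrite orFb => /or3P[] ->; rewrite ?orbT.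
Qed.

End Span.

Section Dimension.
Variable V : vectType R.
Import VectorInternalTheory.

(** Coordinates are indexed by nat, and std_vec i is 0 beyond the dimension, so
    that initial segments of the basis can be handled by recursion. *)
Definition std_vec (i : nat) : V := r2v (\row_j (val j == i)%:R).

Fixpoint std_basis (k : nat) : seq V :=
  if k is k'.+1 then std_vec k' :: std_basis k' else [::].

Lemma size_std_basis k : size (std_basis k) = k.
Proof. by elim: k => //= k ->. Qed.

Lemma v2rZD k (u w : V) : v2r (k *: u + w) = k *: v2r u + v2r w.
Proof. by rewrite linearD linearZ. Qed.

Lemma std_basisP k (v : V) : lin_span (std_basis k) v <->
  (forall j : 'I_(dim V), (k <= j)%N -> v2r v 0 j = 0).
Proof.
elim: k v => [|k IH] v /=.
  split=> [-> j _|v0]; first by rewrite linear0 mxE.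
  apply: v2r_inj; rewrite linear0; apply/rowP => j; rewrite mxE; exact: v0.
split=> [[c [w [/IH w0 ->]]] j kj|v0].
  by rewrite v2rZD r2vK !mxE w0 ?(ltnW kj) // (gtn_eqF kj) mulr0 addr0.
have [kd|dk] := ltnP k (dim V); last first.
  exists 0, v; rewrite scale0r add0r; split=> //; apply/IH => j kj.
  by have := ltn_ord j; lia.
pose i := Ordinal kd; exists (v2r v 0 i), (v - v2r v 0 i *: std_vec k).
split; last by rewrite addrC subrK.
apply/IH => j kj; rewrite linearB linearZ /= r2vK !mxE.
have [->|ji] := eqVneq j i; first by rewrite /= eqxx mulr1 subrr.
have njk : (j == k :> nat) = false.
  by apply/negbTE; apply: contra ji => /eqP jk; apply/eqP/val_inj.
rewrite njk mulr0 subr0; apply: v0; rewrite ltn_neqAle kj andbT eq_sym.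
by rewrite njk.
Qed.

Lemma std_basis_span v : lin_span (std_basis (dim V)) v.
Proof. by apply/std_basisP => j; have := ltn_ord j; lia. Qed.

Lemma std_basis_free k : (k <= dim V)%N -> lin_free (std_basis k).
Proof.
elim: k => //= k IH kd; split; last exact/IH/ltnW.
move=> /std_basisP /(_ (Ordinal kd) (leqnn _)) /eqP.
by rewrite r2vK mxE /= eqxx oner_eq0.
Qed.

Lemma lin_span_proper (s : seq V) :
  (size s < dim V)%N -> exists v, ~ lin_span s v.
Proof.
move=> sd; apply: contrapT => nex.
have spans v : lin_span s v by apply: contrapT => nv; apply: nex; exists v.
have [t [szt _]] := steinitz (std_basis_free (leqnn _)) spans.
by move: sd; rewrite -szt size_std_basis; lia.
Qed.

Lemma lin_free_complete (s : seq V) : lin_free s ->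
  exists t, size s + size t = dim V /\ (forall v, lin_span (s ++ t) v).
Proof.
by move=> /steinitz /(_ std_basis_span); rewrite size_std_basis.
Qed.

End Dimension.
End LinearAlgebra.

(** * Points, lines and flats of an affine space *)

Definition on n (A : affineSpace n) (l : line A) (p : points A) : Prop :=
  sval l p.

(** By shareE this is the positive condition a = b or a ~ b. *)
Definition share n (A : affineSpace n) (a b : line A) : Prop :=
  exists p, on a p /\ on b p.

Section Geometry.
Variables (n : nat) (A : affineSpace n).
Implicit Types (a b c l x y : line A) (o p q r : points A).
Implicit Types (u v w d : directions A) (s : seq (directions A)).

Let sdiv := @scalars_div n A.

Definition diff p q : directions A :=
  sval (cid (translate_simply_transitive p q)).

Lemma translate_diff p q : translate p (diff p q) = q.
Proof. by rewrite /diff; case: cid => v []. Qed.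

Lemma translateI p u v : translate p u = translate p v -> u = v.
Proof.
move=> uv; case: (translate_simply_transitive p (translate p u)) => w [_ wP].
by rewrite -(wP u erefl) -(wP v (esym uv)).
Qed.

Lemma diff_translate p v : diff p (translate p v) = v.
Proof. by apply: (@translateI p); rewrite translate_diff. Qed.

Lemma diffD p q r : diff p q + diff q r = diff p r.
Proof. by apply: (@translateI p); rewrite translateD !translate_diff. Qed.

Lemma diffpp p : diff p p = 0.
Proof. by apply: (@translateI p); rewrite translate_diff translate0. Qed.

Lemma diffN p q : - diff p q = diff q p.
Proof. by apply/eqP; rewrite eq_sym -addr_eq0 diffD diffpp. Qed.

Lemma diffB o p q : diff o q - diff o p = diff p q.
Proof. by rewrite diffN addrC diffD. Qed.

Lemma diff_eq0 p q : diff p q = 0 -> p = q.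
Proof. by move=> d0; rewrite -(translate_diff p q) d0 translate0. Qed.

Definition flat o s p : Prop := lin_span s (diff o p).

Lemma flat_move o s p q : flat o s p -> (flat o s q <-> lin_span s (diff p q)).
Proof.
move=> sp; split=> sq; first by rewrite -(diffB o); apply: lin_spanB.
by rewrite /flat -(diffD o p); apply: lin_spanD.
Qed.

Definition directed l v : Prop :=
  v != 0 /\ forall p q, on l p -> (on l q <-> lin_span [:: v] (diff p q)).

Lemma line_at p v : v != 0 -> exists l, on l p /\ directed l v.
Proof.
move=> v0.
have lP : is_line (range (fun k : scalars A => translate p (k *: v))).
  by exists p, v.
have onP q : on (exist _ _ lP) q <-> flat p [:: v] q.
  split=> [[k _ <-]|/lin_span1[k qE]].
    by apply/lin_span1; exists k; rewrite diff_translate.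
  by exists k => //; rewrite -qE translate_diff.
exists (exist _ _ lP); split; first by apply/onP; rewrite /flat diffpp; apply: lin_span0.
by split=> // q r /onP pq; rewrite onP; apply: flat_move.
Qed.

Lemma line_dir l : exists p v, on l p /\ directed l v.
Proof.
case: l => l [p [v [v0 lE]]]; exists p, v.
have onP q : l q <-> flat p [:: v] q.
  rewrite lE; split=> [[k _ <-]|/lin_span1[k qE]].
    by apply/lin_span1; exists k; rewrite diff_translate.
  by exists k => //; rewrite -qE translate_diff.
split; first by apply/onP; rewrite /flat diffpp; apply: lin_span0.
by split=> // q r /onP pq; rewrite /on /= onP; apply: flat_move.
Qed.

Lemma directed_at l p : on l p -> exists v, directed l v.
Proof. by have [_ [v [_ lv]]] := line_dir l; exists v. Qed.

Lemma line_ext a b : (forall p, on a p <-> on b p) -> a = b.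
Proof.
case: a b => [a la] [b lb] /= ab.
have {}ab : a = b by apply/funext => p; apply/propext/ab.
by subst b; congr exist; apply: Prop_irrelevance.
Qed.

Lemma parallel_eq a b v p :
  directed a v -> directed b v -> on a p -> on b p -> a = b.
Proof.
move=> [_ av] [_ bv] ap bp; apply: line_ext => q.
by rewrite (av p q ap) (bv p q bp).
Qed.

Lemma directed_diff l p q : on l p -> on l q -> p <> q -> directed l (diff p q).
Proof.
move=> lp lq pq; have [v [v0 lv]] := directed_at lp.
have dpq : diff p q != 0 by apply/eqP => /diff_eq0.
have /lin_span1[k dE] := (lv p q lp).1 lq.
split=> // r t lr; rewrite (lv r t lr).
split=> /(lin_span_sub _); apply=> e; rewrite inE => /eqP->.
  apply: (lin_span_divl sdiv (k := k)); last first.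
    by rewrite -dE; apply: lin_span_mem; rewrite inE.
  by apply: contra dpq => /eqP k0; rewrite dE k0 scale0r.
by rewrite dE; apply/lin_spanZ/lin_span_mem; rewrite inE.
Qed.

Lemma line_unique a b p q :
  on a p -> on a q -> on b p -> on b q -> p <> q -> a = b.
Proof.
move=> ap aq bp bq pq.
exact: parallel_eq (directed_diff ap aq pq) (directed_diff bp bq pq) ap bp.
Qed.

Lemma join p q : p <> q -> exists l, on l p /\ on l q.
Proof.
move=> pq; have dpq : diff p q != 0 by apply/eqP => /diff_eq0.
have [l [lp [_ lv]]] := line_at p dpq; exists l; split=> //.
by apply/(lv p q lp)/lin_span_mem; rewrite inE.
Qed.

Lemma line_other l p : exists q, on l q /\ p <> q.
Proof.
have [q [v [lq [v0 lv]]]] := line_dir l.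
have [pq|] := EM (p = q); last by exists q.
exists (translate q v); split.
  by apply/(lv q _ lq); rewrite diff_translate; apply: lin_span_mem; rewrite inE.
rewrite pq -{1}[q]translate0 => /translateI v0'.
by rewrite -v0' eqxx in v0.
Qed.

Lemma line_point l : exists p, on l p.
Proof. by have [p [v []]] := line_dir l; exists p. Qed.

Lemma shareE a b : share a b <-> a = b \/ lines_meet a b.
Proof.
split=> [[p abp]|[->|[_ [p abp]]]]; last by exists p.
  by have [->|] := EM (a = b); [left|right; split=> //; exists p].
by have [p bp] := line_point b; exists p.
Qed.

Lemma line_in_flat l o s p q r : p <> q -> on l p -> on l q ->
  flat o s p -> flat o s q -> on l r -> flat o s r.
Proof.
move=> pq lp lq sp sq lr; apply/(flat_move _ sp).
have [_ /(_ p r lp)/iffLR/(_ lr)] := directed_diff lp lq pq.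
apply: lin_span_sub => e; rewrite inE => /eqP->; exact/(flat_move _ sp).
Qed.

Lemma flat_line l o s p v : directed l v -> lin_span s v ->
  on l p -> flat o s p -> forall q, on l q -> flat o s q.
Proof.
move=> [_ lv] sv lp sp q lq; apply/(flat_move _ sp).
have := (lv p q lp).1 lq.
by apply: lin_span_sub => e; rewrite inE => /eqP->.
Qed.

Lemma span_proper s : (size s < n)%N -> exists v, ~ lin_span s v.
Proof. by move=> sn; apply: lin_span_proper => //; rewrite dim_directions. Qed.

Lemma notin_neq0 s v : ~ lin_span s v -> v != 0.
Proof. by move=> sv; apply/eqP => v0; apply: sv; rewrite v0; apply: lin_span0. Qed.

(** A proper flat is missed by every line that is parallel to it and has a
    point outside. *)
Lemma line_avoiding o s v : (size s < n)%N -> v != 0 -> lin_span s v ->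
  exists x, forall p, on x p -> ~ flat o s p.
Proof.
move=> sn v0 sv; have [w sw] := span_proper sn.
have [x [xp xv]] := line_at (translate o w) v0.
exists x => p xq sp; apply: sw.
by have := flat_line xv sv xq sp xp; rewrite /flat diff_translate.
Qed.

Lemma two_lines p : (1 < n)%N ->
  exists a b, [/\ lines_meet a b, on a p & on b p].
Proof.
move=> n1; have [u /notin_neq0 u0] := @span_proper [::] (ltnW n1).
have [v su] := @span_proper [:: u] n1.
have [a [ap au]] := line_at p u0.
have [b [bp bv]] := line_at p (notin_neq0 su).
exists a, b; split=> //; split; last by exists p.
move=> ab; apply: su; rewrite -(diff_translate p v).
apply/(au.2 p _ ap); rewrite ab; apply/(bv.2 p _ bp).
by rewrite diff_translate; apply: lin_span_mem; rewrite inE.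
Qed.

Lemma line_off p : (1 < n)%N -> exists l, ~ on l p.
Proof.
move=> n1; have [a [b [[ab _] ap bp]]] := two_lines p n1.
have [q [aq pq]] := line_other a p.
have [r [br pr]] := line_other b p.
have [qr|qr] := EM (q = r).
  by case: ab; apply: (line_unique ap aq bp _ pq); rewrite qr.
have [l [lq lr]] := join qr; exists l => lp; apply: ab.
by rewrite (line_unique ap aq lp lq pq) (line_unique bp br lp lr pr).
Qed.

(** * Concurrency and distinctness of points *)

(** Through the common point of three concurrent lines one can join to any
    line. If the three lines form a triangle, a line that has a point on each
    of them lies in their plane, and so misses any line that is disjoint from
    that plane. *)
Lemma concurrentP (n3 : (3 <= n)%N) a b x p :
  a <> b -> on a p -> on b p ->
  (on x p <-> [/\ share x a, share x b & forall z, exists y,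
                    [/\ share y a, share y b, share y x & share y z]]).
Proof.
move=> ab ap bp; split=> [xp|[[q [xq aq]] [r [xr br]] conc]].
  split; [by exists p|by exists p|move=> z].
  have [q [zq pq]] := line_other z p.
  by have [y [yp yq]] := join pq; exists y; split; [exists p|exists p|exists p|exists q].
apply: contrapT => nxp.
have pq : p <> q by move=> pq; apply: nxp; rewrite pq.
have pr : p <> r by move=> pr; apply: nxp; rewrite pr.
have qr : q <> r.
  by move=> qr; apply: ab; apply: (line_unique ap aq bp _ pq); rewrite qr.
pose E := flat p [:: diff p q; diff p r].
have Ep : E p by rewrite /E /flat diffpp; apply: lin_span0.
have Eq : E q by apply: lin_span_mem; rewrite inE eqxx.
have Er : E r by apply: lin_span_mem; rewrite !inE eqxx orbT.
have aE t : on a t -> E t by apply: line_in_flat pq ap aq Ep Eq.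
have bE t : on b t -> E t by apply: line_in_flat pr bp br Ep Er.
have xE t : on x t -> E t by apply: line_in_flat qr xq xr Eq Er.
have [z zE] : exists z, forall t, on z t -> ~ E t.
  apply: (@line_avoiding p _ (diff p q)) => //.
  by apply/eqP => /diff_eq0.
have [y [[i [wi ai]] [j [wj bj]] [k [wk xk]] [t [wt zt]]]] := conc z.
apply: (zE t zt).
have [ij|ij] := EM (i = j); last exact: line_in_flat ij wi wj (aE _ ai) (bE _ bj) wt.
have [ik|ik] := EM (i = k); last exact: line_in_flat ik wi wk (aE _ ai) (xE _ xk) wt.
case: nxp; have [<-|pi] := EM (i = p); first by rewrite ik.
case: ab; rewrite -ij in bj; exact: line_unique ai ap bj bp pi.
Qed.

(** If p and q coincide then two distinct lines through p and q meet only
    there, so only the lines through p satisfy the condition. *)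
Lemma neq_pointsP (n1 : (1 < n)%N) p q :
  p <> q <-> forall x, on x p \/ exists a b r,
    [/\ on a p, on b q, lines_meet a b & [/\ on a r, on b r & on x r]].
Proof.
split=> [pq x|H pq].
  have [xp|nxp] := EM (on x p); [by left|right].
  have [l [lp lq]] := join pq.
  have [r [xr nlr]] : exists r, on x r /\ ~ on l r.
    have [r xr] := line_point x; have [lr|] := EM (on l r); last by exists r.
    have [t [xt rt]] := line_other x r; exists t; split=> // lt.
    by apply: nxp; rewrite (line_unique xr xt lr lt rt).
  have pr : p <> r by move=> pr; apply: nlr; rewrite -pr.
  have qr : q <> r by move=> qr; apply: nlr; rewrite -qr.
  have [a [ap ar]] := join pr; have [b [bq br]] := join qr.
  exists a, b, r; split=> //; split; last by exists r.
  move=> ab; apply: nlr; rewrite -ab in bq.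
  by rewrite (line_unique lp lq ap bq pq).
have [x nxp] := line_off p n1.
have [//|[a [b [r [ap bq [ab _] [ar br xr]]]]]] := H x.
rewrite -pq in bq; apply: ab; apply: (line_unique ap ar bq br) => pr.
by apply: nxp; rewrite pr.
Qed.
End Geometry.

(** * Generating the space from two lines and finitely many points *)

(** Closing X m times under joins of distinct points. The bound m makes this a
    first-order condition of fixed size. *)
Fixpoint gen n (A : affineSpace n) (X : points A -> Prop) m p : Prop :=
  if m is m'.+1 then gen X m' p \/ exists q r l,
    [/\ gen X m' q, gen X m' r, q <> r & [/\ on l q, on l r & on l p]]
  else X p.

(** A positive form of not coplanar, provided that a scalar other than 0 and 1
    exists. Two joining steps per dimension suffice, whence the bound 2 * n. *)
Definition spread n (A : affineSpace n) (a b : line A) : Prop :=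
  exists S : seq (points A), size S = (n - 3)%N /\
    forall x, exists p, on x p /\
      gen (fun q => on a q \/ on b q \/ List.In q S) n.*2 p.

(** Holds for distinct parallel lines, if a scalar other than 0 and 1 exists,
    and never for intersecting ones. *)
Definition par_witness n (A : affineSpace n) (a b : line A) : Prop :=
  exists c, [/\ spread a c, spread b c & forall y,
    spread a y \/ spread b y \/
    (exists p q, p <> q /\ [/\ on a p, on y p, on b q & on y q]) \/
    spread c y \/ lines_meet c y].

(** For n > 2 this characterizes GF(2): the whole space has 2 ^ n points then. *)
Definition blocked n (A : affineSpace n) : Prop :=
  exists S : seq (points A), size S = (2 ^ n)%N /\
    forall x : line A, exists p, on x p /\ List.In p S.

Definition four_points n (A : affineSpace n) (a b : line A) : Prop :=
  exists p q r t, [/\ on a p, on a q, on b r & on b t] /\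
    [/\ p <> q, r <> t, p <> r & [/\ p <> t, q <> r & q <> t]].

Section Generation.
Variables (n : nat) (A : affineSpace n).
Implicit Types (a b c l x y : line A) (o p q r : points A).
Implicit Types (u v w d : directions A) (s : seq (directions A)).
Implicit Types (X : points A -> Prop) (k : scalars A).

Let sdiv := @scalars_div n A.

Lemma gen_flat X o s m p :
  (forall q, X q -> flat o s q) -> gen X m p -> flat o s p.
Proof.
move=> Xs; elim: m p => [|m IH] p /=; first exact: Xs.
move=> [/IH//|[q [r [l [/IH sq /IH sr qr [lq lr lp]]]]]].
exact: line_in_flat qr lq lr sq sr lp.
Qed.

Definition coplanar a b := exists o s, size s = 2%N /\
  forall p, on a p \/ on b p -> flat o s p.

(** Coplanar lines and n - 3 points lie in a common hyperplane, which contains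
    everything generated from them but is missed by some line. *)
Lemma spread_not_coplanar a b : (3 <= n)%N -> spread a b -> ~ coplanar a b.
Proof.
move=> n3 [S [szS Sgen]] [o [s [szs abs]]].
have [p [v [ap av]]] := line_dir a.
have aE q : on a q -> flat o s q by move=> aq; apply: abs; left.
have sv : lin_span s v.
  have := (flat_move (translate p v) (aE p ap)).1.
  rewrite diff_translate; apply; apply: aE; apply/(av.2 _ _ ap).
  by rewrite diff_translate; apply: lin_span_mem; rewrite inE.
pose H := s ++ [seq diff o q | q <- S].
have sH w : lin_span s w -> lin_span H w.
  by apply: lin_span_subseq => e; rewrite mem_cat => ->.
have [||x xP] := @line_avoiding n A o H v _ av.1 _; last first.
- have [q [xq]] := Sgen x.
  have XH t : [\/ on a t, on b t | List.In t S] -> flat o H t.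
    case=> [at_|bt|tS]; [by apply/sH/aE|by apply/sH/abs; right|].
    have : diff o t \in [seq diff o q | q <- S].
      elim: S tS {szS Sgen H sH xP} => //= t' S IH [->|/IH]; rewrite inE.
        by rewrite eqxx.
      by move=> ->; rewrite orbT.
    by move=> tH; apply: lin_span_mem; rewrite mem_cat tH orbT.
  move=> /(@gen_flat _ o H) Hq; apply: (xP q xq); apply: Hq => t [at_|[bt|tS]].
  + by apply: XH; constructor 1.
  + by apply: XH; constructor 2.
  + by apply: XH; constructor 3.
- exact: sH.
- by rewrite size_cat size_map szs szS; lia.
Qed.

Lemma share_coplanar a b : share a b -> coplanar a b.
Proof.
move=> [p [ap bp]]; have [u au] := directed_at ap; have [v bv] := directed_at bp.
have fp : flat p [:: u; v] p by rewrite /flat diffpp; apply: lin_span0.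
exists p, [:: u; v]; split=> // q [aq|bq].
  by apply: (flat_line au _ ap fp aq); apply: lin_span_mem; rewrite inE eqxx.
by apply: (flat_line bv _ bp fp bq); apply: lin_span_mem; rewrite !inE eqxx orbT.
Qed.

Lemma parallel_coplanar a b v : directed a v -> directed b v -> coplanar a b.
Proof.
move=> av bv; have [p ap] := line_point a; have [r br] := line_point b.
have sv : lin_span [:: v; diff p r] v by apply: lin_span_mem; rewrite inE eqxx.
exists p, [:: v; diff p r]; split=> // q [aq|bq].
  by apply: (flat_line av sv ap _ aq); rewrite /flat diffpp; apply: lin_span0.
apply: (flat_line bv sv br _ bq).
by apply: lin_span_mem; rewrite !inE eqxx orbT.
Qed.

Lemma diff_translate2 o v w : diff (translate o v) (translate o w) = w - v.
Proof. by rewrite -(diffB o) !diff_translate. Qed.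

Lemma gen_join X m o v w k : v <> w ->
  gen X m (translate o v) -> gen X m (translate o w) ->
  gen X m.+1 (translate o (v + k *: (w - v))).
Proof.
move=> vw gv gw; right.
have vw' : translate o v <> translate o w by move/translateI.
have [l [lv lw]] := join vw'.
exists (translate o v), (translate o w), l; split=> //; split=> //.
apply/((directed_diff lv lw vw').2 _ _ lv); apply/lin_span1.
by exists k; rewrite !diff_translate2 addrAC subrr add0r.
Qed.

(** Adding one point to a flat: the join with the new point reaches everything
    but the parallel through it, and a scalar other than 0 and 1 gives a third
    point, already reached, on each line from that parallel to the flat. *)
Lemma gen_step (k0 : scalars A) X o s e w0 m : k0 != 0 -> k0 != 1 ->
  (forall w, lin_span s w -> gen X m (translate o w)) ->
  lin_span s w0 -> gen X m (translate o (w0 + e)) ->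
  forall v, lin_span (e :: s) v -> gen X m.+2 (translate o v).
Proof.
move=> k00 k01 sgen sw0 egen.
pose e' := w0 + e.
have [se'|nse'] := EM (lin_span s e') => v [c [w [sw ->]]].
  left; left; apply: sgen; apply: lin_spanD => //; apply: lin_spanZ.
  have -> : e = e' - w0 by rewrite /e' addrAC subrr add0r.
  exact: lin_spanB.
have {}w'E : c *: e + w = (w - c *: w0) + c *: e'.
  by rewrite /e' scalerDr addrA subrK addrC.
have {w sw w'E} [w [sw ->]] : exists w', lin_span s w' /\
    c *: e + w = w' + c *: e'.
  by exists (w - c *: w0); split=> //; apply: lin_spanB => //; apply: lin_spanZ.
have step1 k w' : k != 1 -> lin_span s w' ->
    gen X m.+1 (translate o (w' + k *: e')).
  move=> c1 sw'; pose i := (1 - k)^-1 *: w'.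
  have iU : 1 - k \is a GRing.unit by apply: sdiv; rewrite subr_eq0 eq_sym.
  have -> : w' + k *: e' = i + k *: (e' - i).
    rewrite scalerBr addrCA addrC; congr (_ + _).
    by rewrite -{1}[i]scale1r -scalerBl /i scalerA mulrV ?scale1r.
  apply: gen_join; [|exact/sgen/lin_spanZ|exact: egen].
  by move=> iE; apply: nse'; rewrite -iE; apply: lin_spanZ.
have [->|c1] := eqVneq c 1; last by left; apply: step1.
have -> : w + 1 *: e' = w + k0^-1 *: (w + k0 *: e' - w).
  by rewrite (addrC w (k0 *: e')) addrK scalerA mulVr ?scale1r //; apply: sdiv.
apply: gen_join; [|by left; apply: sgen|exact: step1].
move=> wE; apply: nse'; apply: (lin_span_divl sdiv k00).
have -> : k0 *: e' = 0 by apply: (addrI w); rewrite addr0 -wE.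
exact: lin_span0.
Qed.

Lemma gen_list (k0 : scalars A) X o s t m : k0 != 0 -> k0 != 1 ->
  (forall w, lin_span s w -> gen X m (translate o w)) ->
  (forall e, e \in t -> X (translate o e)) ->
  forall v, lin_span (t ++ s) v -> gen X (m + (size t).*2) (translate o v).
Proof.
move=> k00 k01 sgen; elim: t => [|e t IH] Xt; first by rewrite addn0.
rewrite /= doubleS !addnS; apply: (gen_step (w0 := 0)) k00 k01 _ _ _.
- by apply: IH => e' e't; apply: Xt; rewrite inE e't orbT.
- exact: lin_span0.
- rewrite add0r; have : X (translate o e) by apply: Xt; rewrite inE eqxx.
  by elim: (m + _)%N => //= m' IHm /IHm; left.
Qed.

Lemma spread_complete (k0 : scalars A) a b p r u v : k0 != 0 -> k0 != 1 ->
  on a p -> directed a u -> on b r -> directed b v ->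
  lin_free [:: diff p r; v; u] -> spread a b.
Proof.
move=> k00 k01 ap au br bv fr.
have [t [szt spant]] := lin_free_complete sdiv fr.
rewrite (dim_directions A) /= in szt.
exists [seq translate p e | e <- t]; split; first by rewrite size_map; lia.
move=> x; have [q xq] := line_point x; exists q; split=> //.
set X := (X in gen X).
have Xa w : lin_span [:: u] w -> X (translate p w).
  by move=> uw; left; apply/(au.2 _ _ ap); rewrite diff_translate.
have g0 w : lin_span [::] w -> gen X 0 (translate p w).
  by move=> /= ->; rewrite translate0; left.
have g1 w : lin_span [:: u] w -> gen X 0 (translate p w) by apply: Xa.
have Xr : X r by right; left.
have g2 w : lin_span [:: diff p r; u] w -> gen X 2 (translate p w).
  apply: (gen_step (w0 := 0)) k00 k01 g1 (lin_span0 _) _ _.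
  by rewrite add0r translate_diff.
(* The direction v starts at r, not at p, so the new point here is r + v. *)
have g3 w : lin_span [:: v; diff p r; u] w -> gen X 4 (translate p w).
  apply: (gen_step (w0 := diff p r)) k00 k01 g2 _ _ _.
    by apply: lin_span_mem; rewrite inE eqxx.
  rewrite translateD translate_diff; left; left; right; left.
  apply/(bv.2 _ _ br); rewrite diff_translate.
  by apply: lin_span_mem; rewrite inE eqxx.
have Xt e : e \in t -> X (translate p e).
  move=> et; right; right; elim: t et {szt spant X Xa g0 g1 Xr g2 g3} => //=.
  by move=> e' t IH; rewrite inE => /orP[/eqP->|/IH]; [left|right].
have := gen_list k00 k01 g3 Xt; rewrite -(translate_diff p q) => qgen.
have : gen X (4 + (size t).*2) (translate p (diff p q)).
  apply: qgen; apply: (lin_span_subseq _ (spant _)) => e.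
  by rewrite !mem_cat !inE => /orP[/or3P[]|] ->; rewrite ?orbT.
(* The direction u costs no step, as all of a is given. *)
have -> : n.*2 = ((4 + (size t).*2).+2)%N by lia.
by left; left.
Qed.

Lemma directed_scale l k v : directed l (k *: v) -> directed l v.
Proof.
move=> [kv0 lv].
have v0 : v != 0 by apply: contra kv0 => /eqP->; rewrite scaler0.
have k0 : k != 0 by apply: contra kv0 => /eqP->; rewrite scale0r.
split=> // p q lp; rewrite (lv p q lp).
split=> /(lin_span_sub _); apply=> e; rewrite inE => /eqP->.
  by apply/lin_spanZ/lin_span_mem; rewrite inE.
by apply: (lin_span_divl sdiv k0); apply: lin_span_mem; rewrite inE.
Qed.

(** Two lines share a point, are parallel, or are skew. *)
Lemma line_position a b p r u v :
  on a p -> directed a u -> on b r -> directed b v ->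
  [\/ share a b, directed b u | lin_free [:: diff p r; v; u]].
Proof.
move=> ap au br bv.
have [/lin_span1[k vE]|nuv] := EM (lin_span [:: u] v).
  by constructor 2; rewrite vE in bv; apply: directed_scale bv.
have [[k [w [uw dE]]]|nd] := EM (lin_span [:: v; u] (diff p r)).
  constructor 1; exists (translate p w); split.
    by apply/(au.2 _ _ ap); rewrite diff_translate.
  apply/(bv.2 _ _ br)/lin_span1; exists (- k).
  by rewrite -(diffB p) diff_translate dE opprD addrCA subrr addr0 scaleNr.
constructor 3; split=> //; split=> //; split=> //=.
by apply/eqP; case: au.
Qed.

(** If a and b meet, let y be the line through the common point that is
    parallel to c. It shares a point with a and with b but not two distinct
    ones, and it is coplanar with c but does not meet it. *)
Lemma par_witness_not_meet a b : (3 <= n)%N ->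
  lines_meet a b -> ~ par_witness a b.
Proof.
move=> n3 [ab [p [ap bp]]] [c [ac bc H]].
have ns x y : spread x y -> ~ coplanar x y by apply: spread_not_coplanar.
have [q [v [cq cv]]] := line_dir c.
have [y [yp yv]] := line_at p cv.1.
have ya : y <> a by move=> ya; apply: (ns _ _ ac); rewrite -ya; apply: parallel_coplanar yv cv.
have yb : y <> b by move=> yb; apply: (ns _ _ bc); rewrite -yb; apply: parallel_coplanar yv cv.
have [/ns|[/ns|[[i [j [ij [ai yi bj yj]]]]|[/ns|[yc [j [cj yj]]]]]]] := H y.
- by apply; apply: share_coplanar; exists p.
- by apply; apply: share_coplanar; exists p.
- have [pi|pi] := EM (p = i); last by apply: ya; apply: line_unique yp yi ap ai pi.
  rewrite -pi in ij; apply: yb; exact: line_unique yp yj bp bj ij.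
- by apply; apply: parallel_coplanar cv yv.
- by apply: yc; apply: parallel_eq cv yv cj yj.
Qed.

(** For parallel a and b the witness c passes through a point of their plane
    off both lines, which exists as there are three points on a line, and
    leaves the plane. *)
Lemma disjoint_certificate (k0 : scalars A) a b : (3 <= n)%N ->
  k0 != 0 -> k0 != 1 -> ~ share a b -> spread a b \/ par_witness a b.
Proof.
move=> n3 k00 k01 nab.
have [p [u [ap au]]] := line_dir a; have [r [v [br bv]]] := line_dir b.
have [//|bu|fr] := line_position ap au br bv; last first.
  by left; apply: spread_complete k00 k01 ap au br bv fr.
right; pose d := diff p r.
have nud : ~ lin_span [:: u] d.
  by move=> ud; apply: nab; exists r; split=> //; apply/(au.2 _ _ ap).
have [w nw] : exists w, ~ lin_span [:: d; u] w by apply: span_proper.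
pose q := translate p (k0 *: d).
have [c [cq cw]] := line_at q (notin_neq0 nw).
have nwd k : k != 0 -> ~ lin_span [:: w; u] (k *: d).
  move=> kn0 /(lin_span_divl sdiv kn0) [i [t [ut dE]]].
  have [i0|i0] := eqVneq i 0; first by apply: nud; rewrite dE i0 scale0r add0r.
  apply: nw; apply: (lin_span_divl sdiv i0).
  have -> : i *: w = d - t by rewrite dE addrK.
  apply: lin_spanB; last exact: lin_span_consr.
  by apply: lin_span_mem; rewrite inE eqxx.
have nuw : ~ lin_span [:: u] w by move=> uw; apply: nw; apply: lin_span_consr.
have nwu : ~ lin_span [:: w] u.
  move=> /lin_span1[k uE]; apply: nuw; apply: (lin_span_divl sdiv (k := k)).
    by apply: contraTneq au.1 => k_0; rewrite uE k_0 scale0r eqxx.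
  by rewrite -uE; apply: lin_span_mem; rewrite inE.
have skew_c x t i : directed x u -> on x t -> i != 0 -> diff t q = i *: d ->
    spread x c.
  move=> xu xt i0 tq; apply: spread_complete k00 k01 xt xu cq cw _.
  rewrite tq; split; first exact: nwd.
  by split=> //; split=> //=; apply/eqP; case: au.
have aq : diff p q = k0 *: d by rewrite diff_translate.
have bq : diff r q = (k0 - 1) *: d by rewrite -(diffB p) aq scalerBl scale1r.
have k10 : k0 - 1 != 0 by rewrite subr_eq0.
exists c; split; [exact: skew_c au ap k00 aq|exact: skew_c bu br k10 bq|move=> y].
have [i [dy [yi ydir]]] := line_dir y.
have sk x t : on x t -> directed x u -> [\/ share x y, directed y u | spread x y].
  move=> xt xu; have [sh|yu|fr] := line_position xt xu yi ydir.
  - by constructor 1.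
  - by constructor 2.
  - by constructor 3; apply: spread_complete k00 k01 xt xu yi ydir fr.
have par_y : directed y u -> spread c y \/ lines_meet c y.
  move=> yu; have [cy|yw|fr] := line_position cq cw yi yu.
  - right; have [cy'|//] := (shareE c y).1 cy.
    case: nwu; rewrite -[u](diff_translate q).
    apply/(cw.2 _ _ cq); rewrite cy' in cq *; apply/(yu.2 _ _ cq).
    by rewrite diff_translate; apply: lin_span_mem; rewrite inE.
  - case: nuw; rewrite -[w](diff_translate i).
    apply/(yu.2 _ _ yi)/(yw.2 _ _ yi); rewrite diff_translate.
    by apply: lin_span_mem; rewrite inE.
  - by left; apply: spread_complete k00 k01 cq cw yi yu fr.
have [[s [as_ ys]]|/par_y|ya] := sk a p ap au; last by left.
  have [[t [bt yt]]|/par_y|yb] := sk b r br bu; last by right; left.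
    right; right; left; exists s, t; split=> // st; apply: nab.
    by exists s; split=> //; rewrite st.
  by right; right; right.
by right; right; right.
Qed.

End Generation.

(** * Lines with exactly two points *)

Lemma ltn_exp2_exp3 n : (3 <= n)%N -> (2 ^ n < 3 ^ n.-1)%N.
Proof.
elim: n => // n IH; rewrite leq_eqVlt => /orP[/eqP<- //|n3].
have := IH n3; case: n n3 {IH} => // n _ /=.
by rewrite [(2 ^ n.+2)%N]expnS [(3 ^ n.+1)%N]expnS; lia.
Qed.

Section TwoPointLines.
Variables (n : nat) (A : affineSpace n).
Implicit Types (a b c l x y : line A) (o p q r : points A).
Implicit Types (u v w d : directions A) (s : seq (directions A)).
Import VectorInternalTheory.

Let sdiv := @scalars_div n A.

Lemma four_points_disjoint a b : ~ share a b -> four_points a b.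
Proof.
move=> nab; have [p ap] := line_point a; have [q [aq pq]] := line_other a p.
have [r br] := line_point b; have [t [bt rt]] := line_other b r.
have dis i j : on a i -> on b j -> i <> j.
  by move=> ai bj ij; apply: nab; exists i; split=> //; rewrite ij.
exists p, q, r, t; split=> //; split=> //; last split; exact: dis.
Qed.

Lemma binary_line l p q r : (forall k : scalars A, k = 0 \/ k = 1) ->
  on l p -> on l q -> p <> q -> on l r -> r = p \/ r = q.
Proof.
move=> binary lp lq pq lr.
have /lin_span1[k prE] := ((directed_diff lp lq pq).2 p r lp).1 lr.
have [k0|k1] := binary k; [left|right]; rewrite -(translate_diff p r) prE.
  by rewrite k0 scale0r translate0.
by rewrite k1 scale1r translate_diff.
Qed.

Lemma binary_four_points a b : (forall k : scalars A, k = 0 \/ k = 1) ->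
  four_points a b -> ~ share a b.
Proof.
move=> binary [p [q [r [t [[ap aq br bt] [pq rt pr [pt qr qt]]]]]]] [i [ai bi]].
have [|] := binary_line binary ap aq pq ai => iE;
  by have [|] := binary_line binary br bt rt bi => iE'; rewrite iE in iE'.
Qed.

(** Over GF(2) these are all the linear combinations of s. *)
Fixpoint subset_sums s : seq (directions A) :=
  if s is e :: s' then subset_sums s' ++ [seq e + w | w <- subset_sums s']
  else [:: 0].

Lemma binary_blocked : (forall k : scalars A, k = 0 \/ k = 1) -> blocked A.
Proof.
move=> binary; have [o] := points_inhabited A.
have size_sums s : size (subset_sums s) = (2 ^ size s)%N.
  by elim: s => //= e s IH; rewrite size_cat size_map IH expnS mul2n addnn.
have span_sums s v : lin_span s v -> v \in subset_sums s.
  elim: s v => [|e s IH] v /=; first by move=> ->; rewrite inE.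
  move=> [k [w [/IH sw ->]]]; rewrite mem_cat.
  have [->|->] := binary k; first by rewrite scale0r add0r sw.
  by rewrite scale1r map_f ?orbT.
pose B := std_basis (directions A) (dim (directions A)).
exists [seq translate o v | v <- subset_sums B]; split.
  by rewrite size_map size_sums size_std_basis dim_directions.
move=> x; have [p xp] := line_point x; exists p; split=> //.
rewrite -(translate_diff o p).
have : diff o p \in subset_sums B by apply/span_sums/std_basis_span.
elim: (subset_sums B) => //= v S IH; rewrite inE => /orP[/eqP->|/IH]; by [left|right].
Qed.

Definition coordinate (v : directions A) (j : nat) : scalars A :=
  if insub j is Some i then v2r v 0 (i : 'I_(dim (directions A))) else 0.

Lemma coordinateE (f : nat -> scalars A) k j : (j < n.-1)%N ->
  coordinate (r2v (\row_i f i) + k *: std_vec _ n.-1) j = f j.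
Proof.
move=> jn; have jd : (j < dim (directions A))%N by rewrite dim_directions; lia.
rewrite /coordinate insubT /= linearD linearZ /= !r2vK !mxE /=.
by rewrite (ltn_eqF jn) mulr0 addr0.
Qed.

(** With three scalars, the lines in the last coordinate direction whose other
    coordinates are among these scalars are 3 ^ (n - 1) disjoint lines, each
    of which needs its own blocking point. *)
Lemma ternary_not_blocked (k0 : scalars A) : (3 <= n)%N ->
  k0 != 0 -> k0 != 1 -> ~ blocked A.
Proof.
move=> n3 k00 k01 [S [szS Sx]].
have [o] := points_inhabited A.
pose m := n.-1.
pose value (i : 'I_3) : scalars A := nth 0 [:: 0; 1; k0] i.
pose decode (k : scalars A) : 'I_3 :=
  if k == 0 then 0 else if k == 1 then 1 else 2%:R.
have valueK : cancel value decode.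
  case=> [[|[|[|//]]] i3]; apply/val_inj; rewrite /decode /value /= ?eqxx //.
    by rewrite oner_eq0.
  by rewrite (negbTE k00) (negbTE k01).
pose p k := nth o S k.
pose digits (k : 'I_(2 ^ n)) : {ffun 'I_m -> 'I_3} :=
  [ffun j : 'I_m => decode (coordinate (diff o (p k)) j)].
have hit g : exists k, digits k = g.
  pose f j : scalars A := if insub j is Some i then value (g i) else 0.
  have e0 : std_vec (directions A) m != 0.
    have md : (m < dim (directions A))%N by rewrite dim_directions /m; lia.
    have [nspan _] := std_basis_free md.
    exact: notin_neq0 nspan.
  have [x [xw xe]] := line_at (translate o (r2v (\row_i f i))) e0.
  have [q [xq qS]] := Sx x.
  have [k kS qE] : exists2 k, (k < size S)%N & p k = q.
    rewrite /p; elim: S qS {szS Sx p digits} => //= t S IH [<-|/IH[k kS kE]].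
      by exists 0%N.
    by exists k.+1.
  rewrite szS in kS; exists (Ordinal kS); apply/ffunP => j; rewrite ffunE /= qE.
  have /lin_span1[l lE] := (xe.2 _ q xw).1 xq.
  have -> : diff o q = r2v (\row_i f i) + l *: std_vec _ m.
    by rewrite -lE -[X in X + _](diff_translate o) diffD.
  rewrite coordinateE // /f insubT // => jm.
  by rewrite /= valueK; congr (g _); apply: val_inj.
have [index indexK] := choice hit.
have := leq_card index (can_inj indexK).
rewrite card_ffun !card_ord leqNgt => /negP; apply.
exact: ltn_exp2_exp3.
Qed.

End TwoPointLines.

(** * Renaming variables *)

Local Open Scope nat_scope.

Lemma sat_ext (M : Type) (adj : M -> M -> Prop) f (e e' : nat -> M) :
  (forall j, j \in free_vars f -> e j = e' j) -> sat adj e f <-> sat adj e' f.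
Proof.
have upd g i (e1 e2 : nat -> M) x :
    (forall j, j \in [seq j <- free_vars g | j != i] -> e1 j = e2 j) ->
    forall j, j \in free_vars g -> update e1 i x j = update e2 i x j.
  move=> H j jg; rewrite /update; have [//|ji] := eqVneq j i.
  by apply: H; rewrite mem_filter ji.
elim: f e e' => [i j|i j|g IH|g IHg h IHh|g IHg h IHh|g IHg h IHh|i g IH|i g IH]
  e e' H /=.
- by rewrite (H i) ?(H j) // !inE eqxx ?orbT.
- by rewrite (H i) ?(H j) // !inE eqxx ?orbT.
- by rewrite (IH _ _ H).
1-3: by rewrite (IHg e e') ?(IHh e e') // => j jf; apply: H;
  rewrite /= mem_cat jf ?orbT.
- by split=> E x; apply/(IH _ _ (upd _ _ _ _ x H)).
- by split=> -[x Ex]; exists x; apply/(IH _ _ (upd _ _ _ _ x H)).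
Qed.

(** Bound variables are chosen afresh at each quantifier, above all values that
    s takes on the variables in its scope, so that nothing is captured. *)
Fixpoint rename (s : nat -> nat) (f : formula) : formula :=
  match f with
  | FAdj i j => FAdj (s i) (s j)
  | FEq i j => FEq (s i) (s j)
  | FNot g => FNot (rename s g)
  | FAnd g h => FAnd (rename s g) (rename s h)
  | FOr g h => FOr (rename s g) (rename s h)
  | FImp g h => FImp (rename s g) (rename s h)
  | FForall i g => let m := (\max_(j <- free_vars g) s j).+1 in
      FForall m (rename (fun j => if j == i then m else s j) g)
  | FExists i g => let m := (\max_(j <- free_vars g) s j).+1 in
      FExists m (rename (fun j => if j == i then m else s j) g)
  end.

Lemma positive_rename s f : positive (rename s f) = positive f.
Proof.
by elim: f s => //= [g IHg h IHh|g IHg h IHh] s; rewrite IHg IHh.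
Qed.

Lemma sat_rename (M : Type) (adj : M -> M -> Prop) f s (e : nat -> M) :
  sat adj e (rename s f) <-> sat adj (fun j => e (s j)) f.
Proof.
have bound g i s' (e' : nat -> M) x : let m := (\max_(j <- free_vars g) s' j).+1 in
    sat adj (fun j => update e' m x (if j == i then m else s' j)) g <->
    sat adj (update (fun j => e' (s' j)) i x) g.
  move=> m; apply: sat_ext => j jg; rewrite /update.
  have [_|ji] := eqVneq j i; first by rewrite eqxx.
  by rewrite ltn_eqF // ltnS; apply: leq_bigmax_seq.
elim: f s e => [i j|i j|g IH|g IHg h IHh|g IHg h IHh|g IHg h IHh|i g IH|i g IH]
  s e //=.
- by rewrite IH.
1-3: by rewrite IHg IHh.
- by split=> H x; [apply/bound/IH/H|apply/IH/bound/H].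
- by split=> -[x H]; exists x; [apply/bound/IH/H|apply/IH/bound/H].
Qed.

Lemma free_vars_rename f s i : i \in free_vars (rename s f) ->
  exists2 j, j \in free_vars f & i = s j.
Proof.
have bound g k s' m : (forall s i, i \in free_vars (rename s g) ->
      exists2 j, j \in free_vars g & i = s j) ->
    forall i, i \in [seq j <- free_vars
        (rename (fun j => if j == k then m else s' j) g) | j != m] ->
    exists2 j, j \in [seq j <- free_vars g | j != k] & i = s' j.
  move=> IH {}i; rewrite mem_filter => /andP[im /IH[j jg iE]].
  exists j; last by move: im; rewrite iE; case: (j == k); rewrite ?eqxx.
  rewrite mem_filter jg andbT; apply: contra im => /eqP jk.
  by rewrite iE jk eqxx.
elim: f s i => [a b|a b|g IH|g IHg h IHh|g IHg h IHh|g IHg h IHh|k g IH|k g IH]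
  s i /=.
1-2: by rewrite !inE => /orP[]/eqP->; [exists a|exists b]; rewrite ?inE ?eqxx ?orbT.
- exact: IH.
1-3: by rewrite mem_cat => /orP[/IHg|/IHh] [j jf ->]; exists j;
  rewrite // mem_cat jf ?orbT.
- exact: bound IH _.
- exact: bound IH _.
Qed.

(** * Positively definable properties of lines and points *)

Definition scons (T : Type) (x : T) (e : nat -> T) (i : nat) : T :=
  if i is i'.+1 then e i' else x.

(** The variable 3 i stands for the i-th line, and 3 i + 1 and 3 i + 2 for two
    lines that meet in the i-th point. *)
Definition encodes n (A : affineSpace n) (E e : nat -> line A)
    (pi : nat -> points A) : Prop :=
  forall i, E (3 * i) = e i /\
    [/\ lines_meet (E (3 * i + 1)) (E (3 * i + 2)),
        on (E (3 * i + 1)) (pi i) & on (E (3 * i + 2)) (pi i)].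

(** Environments are infinite and are shifted under quantifiers (de Bruijn), so
    that the closure rules below apply to a predicate as it is written. The
    formula must be correct for every choice of the lines that represent the
    points. *)
Definition definable n
    (P : forall A : affineSpace n,
           (nat -> line A) -> (nat -> points A) -> Prop) : Prop :=
  exists f, positive f /\ forall (A : affineSpace n) E e pi, encodes E e pi ->
    (sat (@lines_meet n A) E f <-> P A e pi).

Section Definability.
Variables (n : nat) (n3 : 3 <= n).

Notation property :=
  (forall A : affineSpace n, (nat -> line A) -> (nat -> points A) -> Prop).
Notation definable := (@definable n).
Implicit Types P Q : property.

Let n1 : 1 < n := ltnW n3.

Lemma definable_ext P Q : (forall A e pi, P A e pi <-> Q A e pi) ->
  definable P -> definable Q.
Proof.
move=> PQ [f [pf fP]]; exists f; split=> // A E e pi En.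
by rewrite (fP _ _ _ _ En).
Qed.

Lemma definable_and P Q : definable P -> definable Q ->
  definable (fun A e pi => P A e pi /\ Q A e pi).
Proof.
move=> [f [pf fP]] [g [pg gQ]]; exists (FAnd f g); split=> /=; first by rewrite pf.
by move=> A E e pi En; rewrite (fP _ _ _ _ En) (gQ _ _ _ _ En).
Qed.

Lemma definable_and3 P Q P' : definable P -> definable Q -> definable P' ->
  definable (fun A e pi => [/\ P A e pi, Q A e pi & P' A e pi]).
Proof.
move=> dP dQ dP'; apply: definable_ext (definable_and dP (definable_and dQ dP')).
by move=> A e pi; split=> [[? []]|[]].
Qed.

Lemma definable_and4 P Q P' Q' :
  definable P -> definable Q -> definable P' -> definable Q' ->
  definable (fun A e pi => [/\ P A e pi, Q A e pi, P' A e pi & Q' A e pi]).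
Proof.
move=> dP dQ dP' dQ'.
apply: definable_ext (definable_and dP (definable_and3 dQ dP' dQ')).
by move=> A e pi; split=> [[? []]|[]].
Qed.

Lemma definable_or P Q : definable P -> definable Q ->
  definable (fun A e pi => P A e pi \/ Q A e pi).
Proof.
move=> [f [pf fP]] [g [pg gQ]]; exists (FOr f g); split=> /=; first by rewrite pf.
by move=> A E e pi En; rewrite (fP _ _ _ _ En) (gQ _ _ _ _ En).
Qed.

(** These make room for a new 0-th line or point: its variables are 0, or 1 and
    2, and what was the i-th one becomes the one with index i + 1. *)
Definition drop_line j := if j %% 3 == 0 then j - 3 else j.
Definition drop_point j := if j %% 3 == 0 then j else j - 3.

Lemma encodes_line (A : affineSpace n) E e pi (x : line A) : encodes E e pi ->
  encodes (update (fun j => E (drop_line j)) 0 x) (scons x e) pi.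
Proof.
move=> En i; have [Ei [m1 o1 o2]] := En i; rewrite /update /drop_line.
have -> : (3 * i + 1 == 0) = false by lia.
have -> : (3 * i + 2 == 0) = false by lia.
have -> : ((3 * i + 1) %% 3 == 0) = false by lia.
have -> : ((3 * i + 2) %% 3 == 0) = false by lia.
split=> //; case: i {Ei m1 o1 o2} => [|i]; first by [].
have -> : (3 * i.+1 == 0) = false by lia.
have -> : (3 * i.+1) %% 3 == 0 by lia.
have -> : 3 * i.+1 - 3 = 3 * i by lia.
by have [] := En i.
Qed.

Lemma encodes_point (A : affineSpace n) E e pi (a b : line A) p :
  encodes E e pi -> lines_meet a b -> on a p -> on b p ->
  encodes (update (update (fun j => E (drop_point j)) 1 a) 2 b) e (scons p pi).
Proof.
move=> En ab ap bp i; have [Ei _] := En i; rewrite /update /drop_point.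
have -> : (3 * i == 2) = false by lia.
have -> : (3 * i == 1) = false by lia.
have -> : (3 * i) %% 3 == 0 by lia.
split=> //; case: i {Ei} => [|i]; first by [].
have -> : (3 * i.+1 + 1 == 2) = false by lia.
have -> : (3 * i.+1 + 1 == 1) = false by lia.
have -> : (3 * i.+1 + 2 == 2) = false by lia.
have -> : (3 * i.+1 + 2 == 1) = false by lia.
have -> : ((3 * i.+1 + 1) %% 3 == 0) = false by lia.
have -> : ((3 * i.+1 + 2) %% 3 == 0) = false by lia.
have -> : 3 * i.+1 + 1 - 3 = 3 * i + 1 by lia.
have -> : 3 * i.+1 + 2 - 3 = 3 * i + 2 by lia.
by have [] := En i.
Qed.

Lemma definable_exL
    (B : forall A : affineSpace n,
      (nat -> line A) -> (nat -> points A) -> line A -> Prop) :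
  definable (fun A e pi => B A (fun i => e i.+1) pi (e 0)) ->
  definable (fun A e pi => exists x, B A e pi x).
Proof.
move=> [f [pf fB]]; exists (rename drop_line (FExists 0 f)).
rewrite positive_rename; split=> // A E e pi En; rewrite sat_rename /=.
by split=> -[x Bx]; exists x; apply/(fB _ _ _ _ (encodes_line x En)).
Qed.

Lemma definable_allL
    (B : forall A : affineSpace n,
      (nat -> line A) -> (nat -> points A) -> line A -> Prop) :
  definable (fun A e pi => B A (fun i => e i.+1) pi (e 0)) ->
  definable (fun A e pi => forall x, B A e pi x).
Proof.
move=> [f [pf fB]]; exists (rename drop_line (FForall 0 f)).
rewrite positive_rename; split=> // A E e pi En; rewrite sat_rename /=.
by split=> Bx x; apply/(fB _ _ _ _ (encodes_line x En)); apply: Bx.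
Qed.

(** Each point lies on two lines, so a pair of meeting lines ranges over all
    points. There is no such rule for universal quantification over points, as
    the condition that two lines meet would become a premise. *)
Lemma definable_exP
    (B : forall A : affineSpace n,
      (nat -> line A) -> (nat -> points A) -> points A -> Prop) :
  definable (fun A e pi => B A e (fun i => pi i.+1) (pi 0)) ->
  definable (fun A e pi => exists p, B A e pi p).
Proof.
move=> [f [pf fB]].
exists (rename drop_point (FExists 1 (FExists 2 (FAnd (FAdj 1 2) f)))).
rewrite positive_rename; split=> // A E e pi En; rewrite sat_rename /=.
rewrite /update /=; split=> [[a [b [ab sf]]]|[p Bp]].
  have [_ [p [ap bp]]] := ab; exists p.
  exact/(fB _ _ _ _ (encodes_point En ab ap bp)).
have [a [b [ab ap bp]]] := two_lines p n1; exists a, b; split=> //.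
exact/(fB _ _ _ _ (encodes_point En ab ap bp)).
Qed.

Lemma definable_meet i j : definable (fun A e pi => lines_meet (e i) (e j)).
Proof.
exists (FAdj (3 * i) (3 * j)); split=> // A E e pi En /=.
by have [-> _] := En i; have [-> _] := En j.
Qed.

Lemma definable_eqL i j : definable (fun A e pi => e i = e j).
Proof.
exists (FEq (3 * i) (3 * j)); split=> // A E e pi En /=.
by have [-> _] := En i; have [-> _] := En j.
Qed.

Lemma definable_on i j : definable (fun A e pi => on (e i) (pi j)).
Proof.
pose sh k l := FOr (FEq k l) (FAdj k l).
pose f := FAnd (sh 2 0) (FAnd (sh 2 1) (FForall 3 (FExists 4
  (FAnd (sh 4 0) (FAnd (sh 4 1) (FAnd (sh 4 2) (sh 4 3))))))).
exists (rename (fun k => nth (3 * i) [:: 3 * j + 1; 3 * j + 2] k) f).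
rewrite positive_rename; split=> // A E e pi En; rewrite sat_rename /= /update /=.
have [-> _] := En i; have [_ [[ab _] ap bp]] := En j.
rewrite (concurrentP n3 _ ab ap bp).
split=> [[/shareE ? [/shareE ? H]]|[/shareE ? /shareE ? H]].
  split=> // z; have [y [/shareE ? [/shareE ? [/shareE ? /shareE ?]]]] := H z.
  by exists y.
do 2!split=> //; move=> z; have [y [/shareE ? /shareE ? /shareE ? /shareE ?]] := H z.
by exists y.
Qed.

Lemma definable_eqP i j : definable (fun A e pi => pi i = pi j).
Proof.
apply: (@definable_ext (fun A e pi => exists a b, lines_meet a b /\
  [/\ on a (pi i), on b (pi i), on a (pi j) & on b (pi j)])) => [A e pi|].
  split=> [[a [b [[ab _] [ai bi aj bj]]]]|ij].
    apply: contrapT => ij; apply: ab; exact: line_unique ai aj bi bj ij.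
  by have [a [b [ab ai bi]]] := two_lines (pi i) n1; exists a, b; rewrite -ij.
apply: definable_exL; apply: definable_exL.
apply: definable_and; first exact: definable_meet.
apply: definable_and4; exact: definable_on.
Qed.

Lemma definable_neqP i j : definable (fun A e pi => pi i <> pi j).
Proof.
apply: definable_ext => [A e pi|]; first by symmetry; apply: (neq_pointsP n1).
apply: definable_allL; apply: definable_or; first exact: definable_on.
do 2!apply: definable_exL; apply: definable_exP.
apply: definable_and4; [exact: definable_on|exact: definable_on| |].
  exact: definable_meet.
by apply: definable_and3; apply: definable_on.
Qed.

Lemma definable_In i J :
  definable (fun A e pi => List.In (pi i) [seq pi j | j <- J]).
Proof.
elim: J => [|j J IH] /=; last by apply: definable_or IH; apply: definable_eqP.
(* An identically false formula: no line meets itself. *)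
apply: definable_ext (definable_meet 0 0) => A e pi.
by split=> // -[].
Qed.

(** The points are bound one by one, and the one that is bound first has the
    largest index, which makes it the last member of S. *)
Lemma definable_exPs m
    (B : forall A : affineSpace n,
      (nat -> line A) -> (nat -> points A) -> seq (points A) -> Prop) :
  definable (fun A e pi =>
    B A e (fun i => pi (m + i)) [seq pi j | j <- iota 0 m]) ->
  definable (fun A e pi => exists S, size S = m /\ B A e pi S).
Proof.
elim: m B => [|m IH] B dB.
  apply: definable_ext dB => A e pi; split=> [B0|[S [/size0nil-> //]]].
  by exists [::].
apply: (@definable_ext (fun A e pi => exists p S, size S = m /\
    B A e pi (rcons S p))) => [A e pi|].
  split=> [[p [S [szS BS]]]|[S [szS BS]]].
    by exists (rcons S p); rewrite size_rcons szS.
  case/lastP: S szS BS => [|S p]; first by [].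
  by rewrite size_rcons => -[szS] BS; exists p, S.
apply: definable_exP.
apply: (IH (fun A e pi S => B A e (fun i => pi i.+1) (rcons S (pi 0)))).
apply: definable_ext dB => A e pi.
rewrite addn0 -addn1 iotaD map_cat /= cats1 add0n.
suff -> : (fun i => pi (m + 1 + i)) = (fun i => pi (m + i.+1)) by [].
by apply/funext => i; rewrite addn1 addSnnS.
Qed.

(** The statement quantifies over shifts a and b of the environments because gen
    binds further points and lines above the parameters of X. *)
Lemma definable_gen
    (X : forall A : affineSpace n,
      (nat -> line A) -> (nat -> points A) -> points A -> Prop) m a b i :
  (forall a b i, definable (fun A e pi =>
     X A (fun j => e (a + j)) (fun j => pi (b + j)) (pi i))) ->
  definable (fun A e pi =>
    gen (X A (fun j => e (a + j)) (fun j => pi (b + j))) m (pi i)).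
Proof.
move=> dX; elim: m a b i => [|m IH] a b i /=; first exact: dX.
apply: definable_or; first exact: IH.
do 2!apply: definable_exP; apply: definable_exL.
apply: definable_and4; [exact: (IH a.+1 b.+2)|exact: (IH a.+1 b.+2)| |].
  exact: definable_neqP.
by apply: definable_and3; apply: definable_on.
Qed.

Lemma definable_spread i j : definable (fun A e pi => spread (e i) (e j)).
Proof.
apply: definable_exPs; apply: definable_allL; apply: definable_exP.
apply: definable_and; first exact: definable_on.
apply: (@definable_gen (fun A e pi q => on (e i) q \/ on (e j) q \/
  List.In q [seq pi k | k <- iota 0 (n - 3)]) _ 1 1 0) => a b k.
apply: definable_or; first exact: definable_on.
apply: definable_or; first exact: definable_on.
apply: definable_ext (definable_In k (iota b (n - 3))) => A e pi.
by rewrite -[b in iota b _]addn0 iotaDl -map_comp.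
Qed.

Lemma definable_par_witness i j :
  definable (fun A e pi => par_witness (e i) (e j)).
Proof.
apply: definable_exL; apply: definable_and3;
  [exact: definable_spread|exact: definable_spread|].
apply: definable_allL.
apply: definable_or; first exact: definable_spread.
apply: definable_or; first exact: definable_spread.
apply: definable_or.
  do 2!apply: definable_exP; apply: definable_and; first exact: definable_neqP.
  by apply: definable_and4; apply: definable_on.
by apply: definable_or; [exact: definable_spread|exact: definable_meet].
Qed.

Lemma definable_blocked : definable (fun A e pi => blocked A).
Proof.
apply: definable_exPs; apply: definable_allL; apply: definable_exP.
apply: definable_and; first exact: definable_on.
apply: definable_ext (definable_In 0 (iota 1 (2 ^ n))) => A e pi.
by rewrite (iotaDl 1 0) -map_comp.
Qed.

Lemma definable_four_points i j :
  definable (fun A e pi => four_points (e i) (e j)).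
Proof.
do 4!apply: definable_exP; apply: definable_and.
  by apply: definable_and4; apply: definable_on.
apply: definable_and4; try exact: definable_neqP.
by apply: definable_and3; apply: definable_neqP.
Qed.

Definition apart (A : affineSpace n) (a b : line A) : Prop :=
  [\/ a = b, spread a b, par_witness a b | blocked A /\ four_points a b].

Lemma apartP (A : affineSpace n) (a b : line A) : apart a b <-> ~ lines_meet a b.
Proof.
have binary_or : (forall k : scalars A, k = 0%R \/ k = 1%R) \/
    (exists k0 : scalars A, k0 != 0%R /\ k0 != 1%R).
  have [|nex] := EM (exists k0 : scalars A, k0 != 0%R /\ k0 != 1%R); first by right.
  left => k; apply: contrapT => k01; apply: nex.
  by exists k; split; apply/eqP => kE; apply: k01; [left|right].
split=> [ab meets|nab].
  have abs : share a b by apply/shareE; right.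
  case: ab => [ab|/(spread_not_coplanar n3)|/(par_witness_not_meet n3 meets)//|[]].
  - by case: meets => /(_ ab).
  - by apply; apply: share_coplanar.
  move=> bl four; case: binary_or => [binary|[k0 [k00 k01]]].
    exact: binary_four_points binary four abs.
  exact: ternary_not_blocked n3 k00 k01 bl.
have [ab|ne] := EM (a = b); first by constructor 1.
have nsh : ~ share a b by move/shareE => [].
case: binary_or => [binary|[k0 [k00 k01]]].
  constructor 4; split; first exact: binary_blocked.
  exact: four_points_disjoint.
have [|] := disjoint_certificate n3 k00 k01 nsh; first by constructor 2.
by constructor 3.
Qed.

Lemma definable_apart i j : definable (fun A e pi => apart (e i) (e j)).
Proof.
apply: (@definable_ext (fun A e pi => e i = e j \/ spread (e i) (e j) \/
  par_witness (e i) (e j) \/ (blocked A /\ four_points (e i) (e j)))).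
  move=> A e pi; split=> [[?|[?|[?|?]]]|[?|?|?|?]].
  - by constructor 1.
  - by constructor 2.
  - by constructor 3.
  - by constructor 4.
  - by left.
  - by right; left.
  - by right; right; left.
  - by right; right; right.
apply: definable_or; first exact: definable_eqL.
apply: definable_or; first exact: definable_spread.
apply: definable_or; first exact: definable_par_witness.
by apply: definable_and; [exact: definable_blocked|exact: definable_four_points].
Qed.

End Definability.

Theorem mainTheorem3 (n : nat) (hn : 3 <= n) :
  exists psi : formula,
    positive psi /\ free_vars psi =i [:: 0; 1] /\
    forall (A : affineSpace n) (a b : line A) (e : nat -> line A),
      e 0 = a -> e 1 = b ->
      (sat (@lines_meet n A) e psi <-> ~ lines_meet a b).
Proof.
have [f [pf fP]] := definable_apart hn 0 1.
(* Lines 0 and 1 have the variables 0 and 3, which become 0 and 1. The variables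
   of all points become 2 and 3, which are bound, so that a and b stay the only
   free variables. The variables of further lines, on which the property does
   not depend, become 0. *)
pose s j := if j == 3 then 1 else j %% 3 + (j %% 3 != 0).
exists (FAnd (FEq 0 0) (FAnd (FEq 1 1)
  (FExists 2 (FExists 3 (FAnd (FAdj 2 3) (rename s f)))))).
split; first by rewrite /= positive_rename.
split=> [i|A a b e ea eb].
  rewrite /= !(inE, mem_filter); apply/idP/idP.
    case/or4P=> [->|->|->|/orP[->|]]; rewrite ?orbT //.
    move=> /and3P[i2 i3 /free_vars_rename[j _ iE]].
    by move: i2 i3; rewrite iE /s; case: ifP; lia.
  by case/orP=> ->; rewrite ?orbT.
rewrite /= -apartP //.
have [o] := points_inhabited A.
pose e' i := if i == 1 then b else a.
have En u v p : lines_meet u v -> on u p -> on v p ->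
    encodes (fun j => update (update e 2 u) 3 v (s j)) e' (fun=> p).
  move=> uv up vp i; rewrite /s.
  have -> : (3 * i + 1 == 3) = false by lia.
  have -> : (3 * i + 2 == 3) = false by lia.
  have -> : (3 * i + 1) %% 3 = 1 by lia.
  have -> : (3 * i + 2) %% 3 = 2 by lia.
  have -> : (3 * i) %% 3 = 0 by lia.
  have -> : (3 * i == 3) = (i == 1) by lia.
  by split=> //; rewrite /e'; case: (i == 1); rewrite /update /= ?ea ?eb.
split=> [[_ [_ [u [v [uv sf]]]]]|ab].
  have [_ [p [up vp]]] := uv.
  by move/sat_rename: sf => /(fP _ _ _ _ (En _ _ _ uv up vp)).
have [u [v [uv up vp]]] := two_lines o (ltnW hn).
do 2!split=> //; exists u, v; split=> //.
by apply/sat_rename/(fP _ _ _ _ (En _ _ _ uv up vp)).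
Qed.
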